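(* Let $p$ be a prime and let $G$ be a finite $p$-group of nilpotency class $2$. With $r$, $s$, $\bar M$ and $\bar N$ as defined in the context, $\operatorname{Autcent}(G) = \operatorname{Aut}_{Z(G)}^{Z(G)}(G)$ if and only if all of the following hold: $r = s$; $(G/Z(G))/\bar{M} \cong (G/\gamma_2(G))/\bar{N}$; and the exponents of $Z(G)$ and $\gamma_2(G)$ are equal.
   Context: $Z(G)$ denotes the center of $G$, $\gamma_2(G)$ the commutator subgroup, and $\operatorname{Aut}(G)$ the automorphism group. An automorphism $\alpha$ of $G$ is central if $x^{-1}\alpha(x) \in Z(G)$ for all $x \in G$; $\operatorname{Autcent}(G)$ is the group of all central automorphisms of $G$. $\operatorname{Aut}_{Z(G)}^{Z(G)}(G)$ is the subgroup of $\operatorname{Aut}(G)$ consisting of all automorphisms that induce the identity on $G/Z(G)$ and fix $Z(G)$ element-wise. $C_{n}$ denotes a cyclic group of order $n$. Since $G$ is a finite $p$-group of class $2$, $G/Z(G)$ and $\gamma_2(G)$ are abelian of equal exponent, denoted $p^c$. Fix a cyclic decomposition $G/Z(G) = C_{p^{a_1}} \times C_{p^{a_2}} \times \cdots \times C_{p^{a_r}}$ with $a_1 \ge a_2 \ge \cdots \ge a_r > 0$. Let $k$ be the largest integer between $1$ and $r$ such that $a_1 = a_2 = \cdots = a_k = c$ (one has $k \ge 2$). Set $\bar{M} = M/Z(G) = C_{p^{a_1}} \times \cdots \times C_{p^{a_k}}$, the product of the first $k$ factors. Fix a cyclic decomposition $G/\gamma_2(G) = C_{p^{b_1}} \times C_{p^{b_2}}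 \times \cdots \times C_{p^{b_s}}$ with $b_1 \ge b_2 \ge \cdots \ge b_s > 0$, such that $\bar{M}$ is isomorphic to a subgroup of $\bar{N} = N/\gamma_2(G) := C_{p^{b_1}} \times C_{p^{b_2}} \times \cdots \times C_{p^{b_k}}$, the product of the first $k$ factors. (Since $G/Z(G)$ is a quotient of $G/\gamma_2(G)$, one has $r \le s$ and $b_j \ge a_j$ for $1 \le j \le r$.) *)

(* Defs.v *)
From mathcomp Require Import all_boot all_fingroup all_solvable.

Set Implicit Arguments.
Unset Strict Implicit.
Unset Printing Implicit Defensive.

Local Open Scope group_scope.

Definition Autcent (gT : finGroupType) (G : {group gT}) : {set {perm gT}} :=
  [set a in Aut G | [forall x in G, x^-1 * a x \in 'Z(G)]].

Definition AutZZ (gT : finGroupType) (G : {group gT}) : {set {perm gT}} :=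
  [set a in Aut G | [forall x in G, coset 'Z(G) (a x) == coset 'Z(G) x]
                  & [forall z in 'Z(G), a z == z]].

(* [H] is the internal direct product of the cyclic groups [A i] of order
   [p ^ a i], with [a] nonincreasing and positive; indices start at 0. *)
Definition cyclic_decomposition (p : nat) (gT : finGroupType) (H : {set gT})
    (n : nat) (A : 'I_n -> {group gT}) (a : 'I_n -> nat) : Prop :=
  [/\ \big[dprod/1]_(i < n) A i = H,
      forall i, cyclic (A i) /\ #|A i| = (p ^ a i)%N,
      forall i j : 'I_n, (i <= j)%N -> (a j <= a i)%N
    & forall i, (0 < a i)%N].

Definition leading_equal (n : nat) (a : 'I_n -> nat) (c k : nat) : Prop :=
  (1 <= k <= n)%N /\ (forall i : 'I_n, (i < k)%N -> a i = c).

Definition largest_leading_equal (n : nat) (a : 'I_n -> nat) (c k : nat) :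
    Prop :=
  leading_equal a c k /\ (forall k', leading_equal a c k' -> (k' <= k)%N).

(* Main.v *)
Require Import Defs.
From mathcomp Require Import all_boot all_fingroup all_solvable.

Set Implicit Arguments.
Unset Strict Implicit.
Unset Printing Implicit Defensive.

Local Open Scope group_scope.

(** Write Z for 'Z(G), let p ^ e be the exponent of Z and put
    L = 'Mho^e(G) <*> G^`(1), where 'Mho^e(G) is generated by the p ^ e-th
    powers.  The proof has two halves, which meet at the condition Z = L.

    Group theory: Autcent G = AutZZ G if and only if Z is contained in L
    ([Autcent_eq_AutZZ], [Autcent_fix_center]).  A central automorphism has
    the form x |-> x * f x with f a homomorphism from G to Z, and such an f
    kills commutators and p ^ e-th powers, hence L.  Conversely, if z in Z lies
    outside L, then some f : G -> Z has f z != 1 ([separating_hom]), and it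
    remains to choose f such that x |-> x * f x is injective.  If Z lies in the
    Frattini subgroup of G, any f will do, because the image of x |-> x * f x
    and 'Phi(G) together generate G.  Otherwise one takes z outside 'Phi(G)
    and f with values in a subgroup <[t]> of order p of G^`(1): it kills
    'Phi(G), hence t, so f (f x) = 1 for all x, and x * f x = 1 forces x = 1.

    Counting: in class 2 the groups G^`(1) and G / Z have the same exponent
    p ^ c, so c <= e and L is contained in Z ([Mho_der1_sub_center]); thus Z
    is contained in L if and only if the indices of L and Z in G agree.
    The index of L is the index of 'Mho^e in G / G^`(1), that is
    p ^ (\sum_j minn (b j) e), and the index of Z is p ^ (\sum_i a i).
    If r = s, e = c and the two quotients have the same order, comparing the
    sums below and above k shows that the index of L is at most that of Z.
    If Z = L, then G / Z and G / G^`(1) also have 'Mho^n of the same index for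
    all n <= e; differences in n give the number of factors of order
    greater than p ^ n for all n < e, and as a and b are nonincreasing these
    equal numbers give r = s and minn (a i) e = minn (b i) e for all i.
    Moreover e > c would force a = b, thus Z = G^`(1) and e = c after all.
    Finally a i = b i whenever a i < c, that is for i >= k, which gives the
    isomorphism. *)

(** * Separating an element from a subgroup containing the derived subgroup *)

(** An element x of maximal order spans a direct factor of W; the complement
    and <[x]> meet trivially, so they cannot both contain w. *)
Lemma monolithic_abelian_cyclic (rT : finGroupType) (W : {group rT}) w :
  abelian W -> w != 1 ->
  (forall V : {group rT}, V \subset W -> V :!=: 1 -> w \in V) -> cyclic W.
Proof.
move=> cWW ntw monoW.
have [x Wx ox] := exponent_witness (abelian_nil cWW).
have [x1 | ntx] := eqVneq x 1.
  rewrite x1 order1 in ox; suff ->: W :=: 1 by exact: cyclic1.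
  apply/trivgP/subsetP=> y Wy; rewrite inE -order_eq1 -dvdn1 -ox.
  exact: dvdn_exponent.
have Xw: w \in <[x]> by apply: monoW; rewrite ?cycle_subG ?cycle_eq1.
case/splitsP: (abelian_splits Wx (esym ox) cWW) => K /complP[tiXK defW].
have [K1 | ntK] := eqVneq (K : {set rT}) 1.
  by rewrite -defW K1 mulg1 cycle_cyclic.
have Kw: w \in K by apply: monoW; rewrite // -defW mulG_subr.
by case/negP: ntw; rewrite -in_set1 -[[set 1]]/(1 : {set rT}) -tiXK inE Xw.
Qed.

(** For Y maximal among the subgroups that contain L and avoid z, every
    nontrivial subgroup of G / Y contains the image of z, so G / Y is cyclic;
    its order divides that of u, so it embeds into <[u]>. *)
Lemma separating_hom (gT : finGroupType) (G L : {group gT}) u z :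
    G^`(1) \subset L -> L \subset G -> z \in G -> z \notin L ->
    exponent (G / L) %| #[u] ->
  exists f : {morphism G >-> gT},
    [/\ f @* G \subset <[u]>, L \subset 'ker f & f z != 1].
Proof.
move=> sG'L sLG Gz L'z expGL.
pose avoids (Y : {group gT}) := [&& Y \subset G & z \notin Y].
have [|Y /maxgroupP[/andP[sYG Y'z] maxY] sLY] := @maxgroup_exists _ avoids L.
  by rewrite /avoids sLG.
have sG'Y := subset_trans sG'L sLY.
have nsYG := sub_der1_normal sG'Y sYG; have nYG := normal_norm nsYG.
have Nz := subsetP nYG z Gz.
have cWW: abelian (G / Y) := sub_der1_abelian sG'Y.
have ntw: coset Y z != 1 by apply: contra Y'z => /eqP/(coset_idr Nz).
have cycW: cyclic (G / Y).
  apply: (monolithic_abelian_cyclic cWW ntw) => V sVW ntV.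
  have [V1 defV sYV1 sV1G] := inv_quotientS nsYG sVW.
  have [V1z | V1'z] := boolP (z \in V1); first by rewrite defV mem_quotient.
  have defY: V1 :=: Y by rewrite (maxY V1) // /avoids sV1G.
  by rewrite defV quotientS1 ?eqxx ?defY in ntV.
have [w defW] := cyclicP cycW.
have ow: #[w] %| #[u].
  rewrite order_dvdn; have: w \in G / Y by rewrite defW cycle_id.
  case/morphimP=> x Nx Gx ->; rewrite -morphX //; apply/eqP/coset_id.
  apply: (subsetP sLY).
  have NLx := subsetP (normal_norm (sub_der1_normal sG'L sLG)) x Gx.
  apply: coset_idr; rewrite ?groupX // morphX //.
  by apply: (exponentP expGL); rewrite mem_quotient.
pose v := u ^+ (#[u] %/ #[w]).
have ov: #[v] = #[w].
  by rewrite orderXdiv ?dvdn_div // divnA // mulKn // order_gt0.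
have dvd_v: #[v] %| #[w] by rewrite ov.
have injv: 'injm (eltm dvd_v) by rewrite injm_eltm ov.
pose f x := eltm dvd_v (coset Y x).
have Wc x: x \in G -> coset Y x \in <[w]>.
  by move=> Gx; rewrite -defW mem_quotient.
have fM: {in G &, {morph f : x y / x * y}}.
  by move=> x y Gx Gy; rewrite /f morphM ?(subsetP nYG) // morphM ?Wc.
exists (Morphism fM); split.
- apply/subsetP=> _ /morphimP[x _ Gx ->] /=.
  apply: (@subsetP _ <[v]>); first by rewrite cycle_subG mem_cycle.
  by rewrite -(im_eltm dvd_v) mem_morphim ?Wc.
- apply/subsetP=> x Lx; have Gx := subsetP sLG x Lx.
  by rewrite !inE Gx /= /f coset_id ?morph1 ?eqxx ?(subsetP sLY).
- apply: contra ntw => /= /eqP fz1; apply/eqP.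
  by apply: (injmP injv); rewrite ?group1 ?Wc // morph1.
Qed.

(** * Central automorphisms as homomorphisms to the center *)

Section CentralAutomorphisms.

Variable gT : finGroupType.
Implicit Types G : {group gT}.

Lemma AutcentP G a :
  reflect (a \in Aut G /\ forall x, x \in G -> x^-1 * a x \in 'Z(G))
          (a \in Autcent G).
Proof.
apply: (iffP setIdP) => [[Aa /forall_inP] | [Aa Za]] //.
by split=> //; apply/forall_inP.
Qed.

Lemma Autcent_hom G a :
    a \in Autcent G ->
  exists f : {morphism G >-> gT},
    f @* G \subset 'Z(G) /\ {in G, forall x, a x = x * f x}.
Proof.
case/AutcentP=> Aa Za.
have aM: {in G &, {morph a : x y / x * y}} by exact: morphicP (Aut_morphic Aa).
have fM: {in G &, {morph (fun x => x^-1 * a x) : x y / x * y}}.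
  move=> x y Gx Gy /=; rewrite aM // invMg mulgA -(mulgA y^-1) [RHS]mulgA.
  by congr (_ * _); apply: centerC (Za x Gx); rewrite groupV.
exists (Morphism fM); split=> [|x Gx]; last by rewrite /= mulKVg.
by apply/subsetP=> _ /morphimP[x _ Gx ->]; exact: Za.
Qed.

Lemma id_mul_central_hom G (f : {morphism G >-> gT}) :
    f @* G \subset 'Z(G) ->
  exists2 g : {morphism G >-> gT},
    g @* G \subset G & {in G, forall x, g x = x * f x}.
Proof.
move=> sfZ.
have Zf x: x \in G -> f x \in 'Z(G).
  by move=> Gx; apply: (subsetP sfZ); rewrite mem_morphim.
have gM: {in G &, {morph (fun x => x * f x) : x y / x * y}}.
  move=> x y Gx Gy /=; rewrite morphM // -!mulgA; congr (_ * _).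
  by rewrite !mulgA; congr (_ * _); apply: centerC (Zf x Gx).
exists (Morphism gM) => //; apply/subsetP=> _ /morphimP[x _ Gx ->] /=.
by rewrite groupM // (subsetP (center_sub G)) ?Zf.
Qed.

Lemma hom_Autcent G (f : {morphism G >-> gT}) :
    f @* G \subset 'Z(G) ->
    {in G, forall x, x * f x = 1 -> x = 1} ->
  exists2 a, a \in Autcent G & {in G, forall x, a x = x * f x}.
Proof.
move=> sfZ inj1f; have [g sgG gE] := id_mul_central_hom sfZ.
have injg: 'injm g.
  apply/subsetP=> x /setIP[Gx]; rewrite !inE => /eqP.
  by rewrite gE // => /(inj1f x Gx)->.
have Gg: g @* G = G by apply/eqP; rewrite eqEcard card_injm // leqnn andbT.
exists (aut injg Gg) => [|x Gx]; last by rewrite autE ?gE.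
apply/AutcentP; rewrite Aut_aut; split=> // x Gx.
by rewrite autE // gE // mulKg (subsetP sfZ) ?mem_morphim.
Qed.

(** The image of x |-> x * f x generates G together with 'Phi(G), so it is G
    by the nongenerator property, and a surjection of G onto G is injective. *)
Lemma Frattini_central_inj G (f : {morphism G >-> gT}) :
    'Z(G) \subset 'Phi(G) -> f @* G \subset 'Z(G) ->
  {in G, forall x, x * f x = 1 -> x = 1}.
Proof.
move=> sZPhi sfZ; have [g sgG gE] := id_mul_central_hom sfZ.
have Gg: g @* G = G.
  rewrite -[LHS]genGid; apply: Phi_nongen; apply/eqP.
  rewrite eqEsubset join_subG Phi_sub sgG; apply/subsetP=> x Gx.
  rewrite -(mulgK (f x) x) -gE // groupM //.
    by rewrite mem_gen // inE mem_morphim ?orbT.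
  rewrite groupV mem_gen // inE (subsetP sZPhi) //.
  by rewrite (subsetP sfZ) ?mem_morphim.
have injg: 'injm g by rewrite -card_im_injm Gg.
by move=> x Gx xfx; apply: (injmP injg); rewrite ?group1 // morph1 gE.
Qed.

Lemma Autcent_eq_AutZZ G :
  Autcent G = AutZZ G <->
  {in Autcent G & 'Z(G), forall (a : {perm gT}) z, a z = z}.
Proof.
have cosZ a x: a \in Aut G -> x \in G ->
    (coset 'Z(G) (a x) == coset 'Z(G) x) = (x^-1 * a x \in 'Z(G)).
  move=> Aa Gx; have nZ := subsetP (normal_norm (center_normal G)).
  have Gax: a x \in G by rewrite Aut_closed.
  rewrite eq_sym eq_mulVg1 -morphV ?nZ // -morphM ?nZ ?groupV //.
  apply/eqP/idP => [|/coset_id//]; apply: coset_idr.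
  by rewrite nZ ?groupM ?groupV.
split=> [eqAA a z | fixZ].
  by rewrite eqAA => /setIdP[_ /andP[_ /forall_inP fixZ]] /fixZ/eqP.
apply/setP=> a; apply/idP/idP=> [Ca | /setIdP[Aa /andP[/forall_inP cosa _]]].
  have [Aa Za] := AutcentP _ _ Ca; apply/setIdP; split=> //; apply/andP; split.
    by apply/forall_inP=> x Gx; rewrite cosZ ?Za.
  by apply/forall_inP=> z Zz; rewrite fixZ.
by apply/AutcentP; split=> // x Gx; rewrite -cosZ ?cosa.
Qed.

Lemma hom_center_kills (p : nat) G (f : {morphism G >-> gT}) e :
    p.-group G -> f @* G \subset 'Z(G) -> exponent 'Z(G) = (p ^ e)%N ->
  'Mho^e(G) <*> G^`(1) \subset 'ker f.
Proof.
move=> pG sfZ expZ; rewrite join_subG (MhoE _ pG) gen_subG; apply/andP; split.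
  apply/subsetP=> _ /imsetP[x Gx ->]; rewrite !inE groupX //= morphX //.
  have/exponentP expZe: exponent 'Z(G) %| p ^ e by rewrite expZ.
  by rewrite expZe // (subsetP sfZ) ?mem_morphim.
apply: der1_min; first exact: ker_norm.
rewrite (isog_abelian (first_isog f)).
exact: abelianS sfZ (center_abelian G).
Qed.

Lemma quotient_Mho_der1_exponent (p : nat) e G : p.-group G ->
  exponent (G / ('Mho^e(G) <*> G^`(1))) %| p ^ e.
Proof.
move=> pG; apply/exponentP=> _ /morphimP[x Nx Gx ->].
rewrite -morphX //; apply: coset_id; rewrite mem_gen // inE.
by rewrite (Mho_p_elt _ Gx) // (mem_p_elt pG).
Qed.

(** In the direct implication, [nofix] turns the hypothesis into: every
    homomorphism f : G -> 'Z(G) with x |-> x * f x injective is trivial on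
    'Z(G).  It is used a first time to place 'Z(G) inside 'Phi(G); after this,
    injectivity is automatic. *)
Lemma Autcent_fix_center (p : nat) G e :
    prime p -> p.-group G -> nil_class G = 2 -> exponent 'Z(G) = (p ^ e)%N ->
  {in Autcent G & 'Z(G), forall (a : {perm gT}) z, a z = z} <->
  'Z(G) \subset 'Mho^e(G) <*> G^`(1).
Proof.
move=> p_pr pG clG expZ.
have sG'Z: G^`(1) \subset 'Z(G) by rewrite -nil_class2 clG.
have sZG := center_sub G.
set L := 'Mho^e(G) <*> G^`(1).
have sLG: L \subset G by rewrite join_subG Mho_sub der_sub.
split=> [fixZ | sZL a z Ca Zz]; last first.
  have [f [sfZ ->]] := Autcent_hom Ca; last exact: (subsetP sZG).
  have /subsetP/(_ z) := subset_trans sZL (hom_center_kills pG sfZ expZ).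
  by move/(_ Zz)/mker->; rewrite mulg1.
have nofix (f : {morphism G >-> gT}) z :
    f @* G \subset 'Z(G) -> {in G, forall x, x * f x = 1 -> x = 1} ->
    z \in 'Z(G) -> f z = 1.
  move=> sfZ inj1f Zz; have [a Ca fa] := hom_Autcent sfZ inj1f.
  by apply: (mulgI z); rewrite -fa ?(subsetP sZG) // mulg1 fixZ.
have sZPhi: 'Z(G) \subset 'Phi(G).
  (* f takes its values in a group <[t]> that it also kills. *)
  apply/subsetP=> z Zz; apply: contraT => Phi'z.
  have [t G't ot] : exists2 t, t \in G^`(1) & #[t] = p.
    have ntG': G^`(1) != 1.
      apply: contra_eqN clG => /eqP/derG1P; rewrite -nil_class1.
      by case: nil_class => [|[]].
    have [_ pG' _] := pgroup_pdiv (pgroupS (der_sub 1 G) pG) ntG'.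
    by have [t] := Cauchy p_pr pG'; exists t.
  have Zt := subsetP sG'Z t G't.
  have sG'Phi: G^`(1) \subset 'Phi(G) by rewrite (Phi_joing pG) joing_subl.
  have expPhi: exponent (G / 'Phi(G)) %| #[t].
    by rewrite ot; case/and3P: (Phi_quotient_abelem pG).
  have [f [sfT skf fz]] :=
    separating_hom sG'Phi (Phi_sub G) (subsetP sZG z Zz) Phi'z expPhi.
  case/eqP: fz; apply: nofix => //.
    by rewrite (subset_trans sfT) ?cycle_subG.
  move=> x Gx xfx1.
  have Tfx: f x \in <[t]> by rewrite (subsetP sfT) ?mem_morphim.
  have Tx: x \in <[t]> by rewrite (canRL (mulgK _) xfx1) mul1g groupV.
  have sTker: <[t]> \subset 'ker f.
    by rewrite cycle_subG (subsetP skf) ?(subsetP sG'Phi).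
  by rewrite -xfx1 (mker (subsetP sTker x Tx)) mulg1.
apply/subsetP=> z Zz; apply: contraT => L'z.
have [u Zu ou] := exponent_witness (abelian_nil (center_abelian G)).
have expL: exponent (G / L) %| #[u].
  by rewrite -ou expZ quotient_Mho_der1_exponent.
have sG'L: G^`(1) \subset L by rewrite joing_subr.
have [f [sfU skf fz]] := separating_hom sG'L sLG (subsetP sZG z Zz) L'z expL.
have sfZ: f @* G \subset 'Z(G) by rewrite (subset_trans sfU) ?cycle_subG.
by case/eqP: fz; apply: nofix => //; exact: Frattini_central_inj.
Qed.

End CentralAutomorphisms.

(** * Exponents in class two *)

(** Since [~ x ^+ n, y] = [~ x, y] ^+ n, the power x ^+ n is central exactly
    when all commutators [~ x, y] have order dividing n. *)
Lemma exponent_der1_center gT (G : {group gT}) :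
  G^`(1) \subset 'Z(G) -> exponent G^`(1) = exponent (G / 'Z(G)).
Proof.
move=> sG'Z; have nZG := normal_norm (center_normal G).
have commX n x y : x \in G -> y \in G -> [~ x ^+ n, y] = [~ x, y] ^+ n.
  move=> Gx Gy; apply: commXg; apply: (centerC Gx).
  by rewrite (subsetP sG'Z) ?mem_commg.
apply/eqP; rewrite eqn_dvd; apply/andP; split.
  have cG'G' : abelian (commg_set G G).
    rewrite derg1 in sG'Z; apply: abelianS (center_abelian G).
    exact: subset_trans (subset_gen _) sG'Z.
  rewrite derg1 abelian_exponent_gen //.
  apply/exponentP=> _ /imset2P[x y Gx Gy ->]; rewrite -commX //.
  apply/eqP/commgP/commute_sym/(centerC Gy); apply: coset_idr.
    by rewrite groupX // (subsetP nZG).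
  rewrite morphX ?(subsetP nZG) //; apply: (exponentP (dvdnn _)).
  by rewrite mem_quotient.
apply/exponentP=> _ /morphimP[x Nx Gx ->]; rewrite -morphX //.
apply/coset_id/centerP; split; first by rewrite groupX.
move=> y Gy; apply/commgP/eqP; rewrite commX //.
by apply: (exponentP (dvdnn _)); rewrite mem_commg.
Qed.

Lemma Mho_der1_sub_center (p : nat) (gT : finGroupType) (G : {group gT}) c e :
    prime p -> p.-group G -> nil_class G = 2 ->
    exponent (G / 'Z(G)) = (p ^ c)%N -> exponent 'Z(G) = (p ^ e)%N ->
  c <= e /\ 'Mho^e(G) <*> G^`(1) \subset 'Z(G).
Proof.
move=> p_pr pG clG expG expZ.
have sG'Z: G^`(1) \subset 'Z(G) by rewrite -nil_class2 clG.
have le_ce: c <= e.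
  rewrite -(dvdn_Pexp2l _ _ (prime_gt1 p_pr)) -expG -expZ.
  by rewrite -exponent_der1_center // exponentS.
split=> //; rewrite join_subG sG'Z andbT (MhoE _ pG) gen_subG.
apply/subsetP=> _ /imsetP[x Gx ->].
have Nx := subsetP (normal_norm (center_normal G)) x Gx.
apply: coset_idr; rewrite ?groupX ?morphX //.
have/exponentP expGe: exponent (G / 'Z(G)) %| p ^ e by rewrite expG dvdn_exp2l.
by rewrite expGe ?mem_quotient.
Qed.

(** * Direct products of cyclic p-groups *)

Lemma bigdprod_sub (gT : finGroupType) (I : finType) (A : I -> {group gT})
    (H : {group gT}) i : \big[dprod/1]_i A i = H -> A i \subset H.
Proof. by move/bigdprodWY<-; rewrite sub_gen // (bigcup_sup i). Qed.

Lemma Mho_bigdprod n (gT : finGroupType) (I : Type) (r : seq I) (P : pred I)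
    (F : I -> {set gT}) (G : {group gT}) :
  \big[dprod/1]_(i <- r | P i) F i = G ->
  \big[dprod/1]_(i <- r | P i) 'Mho^n(F i) = 'Mho^n(G).
Proof.
elim/big_rec2: _ G => [_ <-|i A Z _ IH G dG]; first by rewrite Mho1.
rewrite -(Mho_dprod n dG); case/dprodP: dG => [[_ H _ dH] _ _ _].
by rewrite dH (IH H dH).
Qed.

Section CyclicDprod.

Variables (p : nat) (gT : finGroupType) (I : finType) (P : pred I).
Variables (A : I -> {group gT}) (a : I -> nat) (X : {group gT}).
Hypotheses (p_pr : prime p) (defX : \big[dprod/1]_(i | P i) A i = X).
Hypothesis cycA : forall i, cyclic (A i) /\ #|A i| = (p ^ a i)%N.

Lemma card_bigdprod_cyclic : #|X| = (p ^ \sum_(i | P i) a i)%N.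
Proof.
rewrite -(bigdprod_card defX) expn_sum.
by apply: eq_bigr => i _; case: (cycA i).
Qed.

Lemma index_Mho_bigdprod n :
  #|X : 'Mho^n(X)| = (p ^ \sum_(i | P i) minn (a i) n)%N.
Proof.
have cardMho i : #|'Mho^n(A i)| = (p ^ (a i - n))%N.
  have [/cyclicP[x ->] ox] := cycA i.
  have px : p.-elt x by rewrite /p_elt /order ox pnatX pnat_id.
  rewrite (Mho_p_cycle _ px) -orderE; have [le_na | lt_an] := leqP n (a i).
    by rewrite orderXdiv orderE ox ?dvdn_exp2l // expnB ?prime_gt0.
  rewrite (eqP (_ : x ^+ (p ^ n) == 1)) ?order1.
    by rewrite (eqP (ltnW lt_an)).
  by rewrite -order_dvdn orderE ox dvdn_exp2l // ltnW.
have cardXn : #|'Mho^n(X)| = (p ^ \sum_(i | P i) (a i - n))%N.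
  rewrite -(bigdprod_card (Mho_bigdprod n defX)) expn_sum.
  exact: eq_bigr.
apply/eqP; rewrite -(eqn_pmul2l (cardG_gt0 'Mho^n(X))) Lagrange ?Mho_sub //.
rewrite cardXn card_bigdprod_cyclic -expnD -big_split /=.
apply/eqP; congr (_ ^ _)%N; apply: eq_bigr => i _.
by rewrite minnE addnC subnK // leq_subr.
Qed.

Lemma abelian_type_bigdprod :
    (forall i, 0 < a i) ->
  perm_eq (abelian_type X) [seq (p ^ a i)%N | i <- index_enum I & P i].
Proof.
move=> a_gt0; have genA i : {x | A i == <[x]> :> {set gT}}.
  by apply: sigW; have [/cyclicP[x ->] _] := cycA i; exists x.
pose x i := sval (genA i); have defA i : A i :=: <[x i]>.
  by apply/eqP; rewrite /x; case: (genA i).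
have ox i : #[x i] = (p ^ a i)%N by rewrite orderE -defA; case: (cycA i).
have pX : p.-group X by rewrite /pgroup card_bigdprod_cyclic pnatX pnat_id.
rewrite (eq_map (fun i => esym (ox i))) map_comp.
apply: (abelian_type_pgroup pX).
  rewrite big_map big_filter -defX; by apply: eq_bigr => i _; rewrite defA.
apply/mapP=> -[i _ /esym/eqP]; rewrite -order_eq1 ox => /eqP pa1.
have: 1 < p ^ a i by rewrite -(expn0 p) ltn_exp2l ?prime_gt1.
by rewrite pa1.
Qed.

End CyclicDprod.

(** Both products have the same multiset of orders of cyclic factors, hence
    the same abelian type. *)
Lemma isog_bigdprod_cyclic (p : nat) (gT rT : finGroupType) (I : finType)
    (P : pred I) (A : I -> {group gT}) (B : I -> {group rT})
    (a b : I -> nat) (X : {group gT}) (Y : {group rT}) :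
    prime p -> abelian X -> abelian Y ->
    \big[dprod/1]_(i | P i) A i = X -> \big[dprod/1]_(i | P i) B i = Y ->
    (forall i, cyclic (A i) /\ #|A i| = (p ^ a i)%N) ->
    (forall i, cyclic (B i) /\ #|B i| = (p ^ b i)%N) ->
    (forall i, 0 < a i) -> (forall i, 0 < b i) ->
    (forall i, P i -> a i = b i) ->
  X \isog Y.
Proof.
move=> p_pr cXX cYY defX defY cycA cycB a_gt0 b_gt0 eq_ab.
rewrite eq_abelian_type_isog //; apply/eqP.
apply: (@sorted_eq _ geq).
- by move=> m n q le_mn le_qm; apply: leq_trans le_qm le_mn.
- by move=> m n /andP[le1 le2]; apply/eqP; rewrite eqn_leq; apply/andP.
- exact: abelian_type_sorted.
- exact: abelian_type_sorted.
rewrite (permPl (abelian_type_bigdprod p_pr defX cycA a_gt0)) perm_sym.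
rewrite (permPl (abelian_type_bigdprod p_pr defY cycB b_gt0)).
suff -> : [seq (p ^ a i)%N | i <- index_enum I & P i]
        = [seq (p ^ b i)%N | i <- index_enum I & P i] by [].
by apply/eq_in_map=> i; rewrite mem_filter => /andP[/eq_ab-> _].
Qed.

Lemma bigdprod_complement (gT : finGroupType) (I : finType) (P : pred I)
    (A : I -> {set gT}) (H M : {group gT}) :
    \big[dprod/1]_i A i = H -> \big[dprod/1]_(i | P i) A i = M ->
  exists X : {group gT},
    [/\ \big[dprod/1]_(i | ~~ P i) A i = X, X \subset H & X \isog H / M].
Proof.
rewrite (bigID P) /= => defH defM; rewrite defM in defH.
have [[_ X _ defX] defMX _ _] := dprodP defH; exists X; split=> //.
  by rewrite -defMX defX mulG_subr.
by apply: sdprod_isog; apply: dprodWsd; rewrite -defX.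
Qed.

(** * Indices and nonincreasing sequences *)

Lemma index_Mho_quotient n gT (G N : {group gT}) :
  N <| G -> #|G / N : 'Mho^n(G / N)| = #|G : 'Mho^n(G) <*> N|.
Proof.
case/andP=> sNG nNG; have nNMho := subset_trans (Mho_sub n G) nNG.
rewrite -morphim_Mho // -[_ @* _]/('Mho^n(G) / N) -(quotientYidr nNMho).
rewrite index_quotient_eq ?join_subG ?Mho_sub //.
by rewrite (setIidPr sNG) joing_subr.
Qed.

Lemma sum_ltn_ord n j : j <= n -> (\sum_(i < n) (i < j))%N = j.
Proof.
move=> le_jn; rewrite -{2}[j]card_ord -sum1_card.
rewrite (big_ord_widen n (fun=> 1%N)) //.
by rewrite [RHS]big_mkcond; apply: eq_bigr => i _; case: ltnP.
Qed.

(** The indices j with m < a j form an initial segment, so their number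
    decides which ones they are. *)
Lemma nonincreasing_gtE n (a : 'I_n -> nat) m (j : 'I_n) :
    (forall i i' : 'I_n, i <= i' -> a i' <= a i) ->
  (m < a j) = (j < \sum_(i < n) (m < a i)).
Proof.
move=> a_dec; apply/idP/idP=> [lt_m_aj | ].
  rewrite -[j.+1](sum_ltn_ord (ltn_ord j)); apply: leq_sum => i _.
  by case: (ltnP i j.+1) => //= /a_dec/(leq_trans lt_m_aj)->.
apply: contraTT; rewrite -!leqNgt => le_aj_m.
rewrite -[X in _ <= X](sum_ltn_ord (ltnW (ltn_ord j))); apply: leq_sum => i _.
case: (ltnP i j) => //= [_|/a_dec/leq_trans/(_ le_aj_m)]; first exact: leq_b1.
by rewrite leqNgt => /negbTE->.
Qed.

Lemma sum_minnS n (a : 'I_n -> nat) m :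
  (\sum_(i < n) minn (a i) m.+1
     = \sum_(i < n) minn (a i) m + \sum_(i < n) (m < a i))%N.
Proof.
rewrite -big_split; apply: eq_bigr => i _ /=.
have [lt_ma | le_am] := ltnP m (a i).
  by rewrite (minn_idPr _) ?(minn_idPr _) ?addn1 // ltnW.
by rewrite !(minn_idPl _) ?addn0 // leqW.
Qed.

(** * The two conditions compared *)

Theorem mainTheorem1 (p : nat) (gT : finGroupType) (G : {group gT})
  (p_prime : prime p) (pG : p.-group G) (clG : nil_class G = 2)
  (c : nat) (expG : exponent (G / 'Z(G)) = (p ^ c)%N)
  (r : nat) (A : 'I_r -> {group coset_of 'Z(G)}) (a : 'I_r -> nat)
  (decA : cyclic_decomposition p (G / 'Z(G)) A a)
  (k : nat) (k_max : largest_leading_equal a c k)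
  (Mbar : {group coset_of 'Z(G)})
  (defMbar : \big[dprod/1]_(i < r | (i < k)%N) A i = Mbar)
  (s : nat) (B : 'I_s -> {group coset_of G^`(1)}) (b : 'I_s -> nat)
  (decB : cyclic_decomposition p (G / G^`(1)) B b)
  (Nbar : {group coset_of G^`(1)})
  (defNbar : \big[dprod/1]_(j < s | (j < k)%N) B j = Nbar)
  (embMN : exists2 K : {group coset_of G^`(1)}, K \subset Nbar & Mbar \isog K) :
  Autcent G = AutZZ G <->
  [/\ r = s,
      (G / 'Z(G)) / Mbar \isog (G / G^`(1)) / Nbar
    & exponent 'Z(G) = exponent G^`(1)].
Proof.
have [[[/andP[k_gt0 le_kr] a_k] k_largest] p_gt1] := (k_max, prime_gt1 p_prime).
have [defQ cycA a_dec a_gt0] := decA; have [defH cycB b_dec b_gt0] := decB.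
have sG'Z: G^`(1) \subset 'Z(G) by rewrite -nil_class2 clG.
have pZ: p.-nat (exponent 'Z(G)).
  by rewrite pnat_exponent (pgroupS (center_sub G)).
have [e expZ] := p_natP pZ.
have expG' := exponent_der1_center sG'Z; rewrite expG in expG'.
have [le_ce sLZ] := Mho_der1_sub_center p_prime pG clG expG expZ.
have nsZG := center_normal G; have nsG'G := der_normal 1 G.
have a_le_c i: a i <= c.
  have [cycAi oAi] := cycA i.
  rewrite -(leq_exp2l _ _ p_gt1) -expG dvdn_leq ?exponent_gt0 // -oAi.
  by rewrite -exponent_cyclic // exponentS // (bigdprod_sub i defQ).
have a_lt_c (i : 'I_r) : k <= i -> a i < c.
  move=> le_ki; rewrite ltn_neqAle a_le_c andbT; apply/eqP=> ai_c.
  have /k_largest: leading_equal a c k.+1.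
    split; first by rewrite (leq_ltn_trans le_ki).
    move=> j; rewrite ltnS => le_jk; apply/eqP; rewrite eqn_leq a_le_c.
    by rewrite -ai_c a_dec // (leq_trans le_jk).
  by rewrite ltnn.
have c_gt0: 0 < c.
  by rewrite -(a_k (Ordinal (leq_trans k_gt0 le_kr)) k_gt0) a_gt0.
have cardQ: #|G : 'Z(G)| = (p ^ \sum_(i < r) a i)%N.
  by rewrite -(card_bigdprod_cyclic defQ cycA) card_quotient ?normal_norm.
have indH n: #|G : 'Mho^n(G) <*> G^`(1)| = (p ^ \sum_(j < s) minn (b j) n)%N.
  by rewrite -index_Mho_quotient // (index_Mho_bigdprod p_prime defH cycB).
have indQ n: #|G : 'Mho^n(G) <*> 'Z(G)| = (p ^ \sum_(i < r) minn (a i) n)%N.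
  by rewrite -index_Mho_quotient // (index_Mho_bigdprod p_prime defQ cycA).
have [X [defX sXQ isoX]] := bigdprod_complement defQ defMbar.
have [Y [defY sYH isoY]] := bigdprod_complement defH defNbar.
apply: (iff_trans (Autcent_eq_AutZZ G)).
apply: (iff_trans (Autcent_fix_center p_prime pG clG expZ)).
split=> [sZL | [eq_rs isoXY expZG']].
  have defZ: 'Z(G) = 'Mho^e(G) <*> G^`(1) by apply/eqP; rewrite eqEsubset sZL.
  have eq_min n : n <= e ->
      (\sum_(i < r) minn (a i) n = \sum_(j < s) minn (b j) n)%N.
    move=> le_ne; apply/eqP; rewrite -(eqn_exp2l _ _ p_gt1) -indQ -indH defZ.
    by rewrite joingA (joing_idPl (Mho_leq G le_ne)).
  have eq_count n : n < e ->
      (\sum_(i < r) (n < a i) = \sum_(j < s) (n < b j))%N.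
    move=> lt_ne; apply/eqP; rewrite -(eqn_add2l (\sum_(i < r) minn (a i) n)).
    by rewrite -sum_minnS eq_min // sum_minnS eq_min // ltnW.
  (* All a i and b j are positive, so level 0 counts all the factors. *)
  have eq_rs: r = s.
    have:= eq_count 0 (leq_trans c_gt0 le_ce).
    rewrite (eq_bigr (fun=> 1%N)) => [|i _]; last by rewrite a_gt0.
    rewrite [RHS](eq_bigr (fun=> 1%N)) => [|i _]; last by rewrite b_gt0.
    by rewrite !sum1_card !card_ord.
  subst s.
  have gtE n i : n < e -> (n < a i) = (n < b i).
    by move=> lt_ne; rewrite !nonincreasing_gtE // eq_count.
  (* If c < e, no b i exceeds c, so truncation at e changes neither sequence
     and 'Z(G) has the order of G^`(1), whose exponent is p ^ c. *)
  have eq_ce: e = c.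
    apply/eqP; rewrite eqn_leq le_ce andbT leqNgt; apply/negP=> lt_ce.
    have eq_ab: (\sum_(i < r) a i = \sum_(i < r) b i)%N.
      have b_le_c i : b i <= c by rewrite leqNgt -gtE // -leqNgt.
      have:= eq_min e (leqnn e).
      rewrite (eq_bigr a) => [|i _]; last first.
        by apply/minn_idPl/(leq_trans (a_le_c i)).
      rewrite [RHS](eq_bigr b) // => i _.
      by apply/minn_idPl/(leq_trans (b_le_c i)).
    have ZG': 'Z(G) = G^`(1).
      apply/eqP; rewrite eq_sym eqEcard sG'Z.
      rewrite -(leq_pmul2r (indexg_gt0 G 'Z(G))) Lagrange ?center_sub //.
      rewrite cardQ eq_ab -(card_bigdprod_cyclic defH cycB).
      by rewrite card_quotient ?normal_norm //= Lagrange ?der_sub.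
    move/eqP: expZ; rewrite ZG' expG' eqn_exp2l // => /eqP eq_ce.
    by rewrite eq_ce ltnn in lt_ce.
  subst e; split=> //; last by rewrite expZ expG'.
  apply: isog_trans (isoY); rewrite isog_sym in isoX; apply: isog_trans isoX _.
  have cQQ: abelian (G / 'Z(G)) by rewrite sub_der1_abelian.
  have cHH: abelian (G / G^`(1)) by rewrite sub_der1_abelian.
  apply: (isog_bigdprod_cyclic p_prime _ _ defX defY cycA cycB a_gt0 b_gt0).
  - exact: abelianS cQQ.
  - exact: abelianS cHH.
  move=> i; rewrite -leqNgt => /a_lt_c lt_ac.
  apply/eqP; rewrite eqn_leq; apply/andP; split; rewrite leqNgt.
    apply/negP=> lt_ba; move: (gtE (b i) i (ltn_trans lt_ba lt_ac)).
    by rewrite lt_ba ltnn.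
  by rewrite -gtE ?ltnn.
have eq_ec: e = c.
  by apply/eqP; rewrite -(eqn_exp2l _ _ p_gt1) -expZ expZG' expG'.
subst s e.
have cardXY: (\sum_(i < r | ~~ (i < k)) a i = \sum_(i < r | ~~ (i < k)) b i)%N.
  apply/eqP; rewrite -(eqn_exp2l _ _ p_gt1) -(card_bigdprod_cyclic defX cycA).
  rewrite -(card_bigdprod_cyclic defY cycB) (card_isog isoX) (card_isog isoY).
  by rewrite (card_isog isoXY).
(* For i < k, minn (b i) c <= c = a i; for i >= k, the sums of b and of a
   agree. *)
suff <- : 'Mho^c(G) <*> G^`(1) = 'Z(G) by [].
have sLG := subset_trans sLZ (center_sub G).
apply/eqP; rewrite eqEcard sLZ.
rewrite -(leq_pmul2r (indexg_gt0 G ('Mho^c(G) <*> G^`(1)))).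
rewrite Lagrange // -(Lagrange (center_sub G)) leq_pmul2l ?cardG_gt0 //.
rewrite indH cardQ leq_exp2l // (bigID (fun i : 'I_r => i < k)) /=.
rewrite [leqRHS](bigID (fun i : 'I_r => i < k)) /= cardXY leq_add //.
  by apply: leq_sum => i lt_ik; rewrite a_k // geq_minr.
by apply: leq_sum => i _; rewrite geq_minl.
Qed.
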